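(* Let $\mathcal{X}$ and $\mathcal{S}$ be finite nonempty sets with $|\mathcal{S}|=k\le|\mathcal{X}|$, fix a probability distribution $Q_X$ on $\mathcal{X}$, let $P_S$ be the uniform distribution on $\mathcal{S}$, let $\pi_1=\tfrac12$ (so $\pi_0=1-\pi_1=\tfrac12$), and put $\gamma=\pi_1/\pi_0$. Then, with the supremum taken over all conditional distributions $Q_{X|S}$ for which the optimal perception probability satisfies $\mathsf{R}_p=\tfrac12$ (equivalently $\bar Q_X=Q_X$), the optimal detection probability $\mathsf{R}_d$ satisfies $$\frac12\;\le\;\sup_{Q_{X|S}}\mathsf{R}_d\;\le\;\max\left(\frac12,\;1-\frac{\gamma}{2k}\right).$$
   Context: Given distributions $Q_X$ on $\mathcal{X}$, $P_S$ on $\mathcal{S}$, and a conditional distribution (kernel) $Q_{X|S}$ from $\mathcal{S}$ to $\mathcal{X}$, write $\bar Q_X=\sum_{s}P_S(s)Q_{X|S=s}$. A side-information variable $S\sim P_S$ is drawn. Under hypothesis $H_0$ (label $C=0$) a token $A\sim Q_X$ is drawn independently of $S$, so $(A,S)\sim Q_XP_S$; under hypothesis $H_1$ (label $C=1$) $A\sim Q_{X|S}$, so $(A,S)\sim Q_{X|S}P_S$. The optimal detection probability with priors $(\pi_0,\pi_1)$ is $$\mathsf{R}_d=\max_{g_d:\mathcal{X}\times\mathcal{S}\to\{0,1\}}\big[\pi_0\Pr(g_d(A,S)=0\mid H_0)+\pi_1\Pr(g_d(A,S)=1\mid H_1)\big].$$ The optimal perception probability $\mathsf{R}_p$ is the analogous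 maximum with priors $(\tfrac12,\tfrac12)$ over tests $g_c:\mathcal{X}\to\{0,1\}$ that see only $A$ (i.e. testing $A\sim Q_X$ against $A\sim\bar Q_X$), and equals $\tfrac12+\tfrac12\mathsf{TV}(\bar Q_X,Q_X)$, where $\mathsf{TV}(P,Q)=\tfrac12\sum_x|P(x)-Q(x)|$. *)

(* Defs.v *)
From mathcomp Require Import all_boot all_order all_algebra.
From mathcomp Require Import classical_sets reals.

Set Implicit Arguments.
Unset Strict Implicit.
Unset Printing Implicit Defensive.

Import Order.TTheory GRing.Theory Num.Theory.
Local Open Scope ring_scope.

Definition is_dist (R : realType) (T : finType) (P : T -> R) : Prop :=
  (forall t, 0 <= P t) /\ \sum_t P t = 1.

Definition uniform (R : realType) (T : finType) : T -> R := fun=> #|T|%:R^-1.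
Arguments uniform R T : clear implicits.

Definition prob (R : realType) (T : finType) (P : T -> R) (E : pred T) : R :=
  \sum_(t | E t) P t.

(* A conditional distribution Q_{X|S} is Q : S -> X -> R with
   Q s x = Q_{X|S}(x|s). *)
Definition is_kernel (R : realType) (S X : finType) (Q : S -> X -> R) : Prop :=
  forall s, is_dist (Q s).

Definition mixture (R : realType) (S X : finType)
    (PS : S -> R) (Q : S -> X -> R) : X -> R :=
  fun x => \sum_s PS s * Q s x.

(* Probability that the test g declares the right hypothesis, where H_i has
   prior pi_i and law P_i; g t = false declares H_0 and g t = true declares
   H_1. *)
Definition success (R : realType) (T : finType) (pi0 pi1 : R) (P0 P1 : T -> R)
    (g : {ffun T -> bool}) : R :=
  pi0 * prob P0 (fun t => g t == false) + pi1 * prob P1 (fun t => g t == true).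

(* The maximum over all tests; the initial value of the iterated maximum is
   the score of a particular test, so it does not affect the result. *)
Definition opt_success (R : realType) (T : finType) (pi0 pi1 : R)
    (P0 P1 : T -> R) : R :=
  \big[Num.max / success pi0 pi1 P0 P1 [ffun=> false]]_(g : {ffun T -> bool})
    success pi0 pi1 P0 P1 g.

Definition joint0 (R : realType) (S X : finType) (PS : S -> R) (QX : X -> R) :
    X * S -> R :=
  fun t => QX t.1 * PS t.2.

Definition joint1 (R : realType) (S X : finType) (PS : S -> R)
    (Q : S -> X -> R) : X * S -> R :=
  fun t => Q t.2 t.1 * PS t.2.

Definition Rd (R : realType) (S X : finType) (pi0 pi1 : R)
    (PS : S -> R) (QX : X -> R) (Q : S -> X -> R) : R :=
  opt_success pi0 pi1 (joint0 PS QX) (joint1 PS Q).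

Definition Rp (R : realType) (S X : finType)
    (PS : S -> R) (QX : X -> R) (Q : S -> X -> R) : R :=
  opt_success (1 / 2%:R) (1 / 2%:R) QX (mixture PS Q).

Definition perfect_perception (R : realType) (S X : finType)
    (PS : S -> R) (QX : X -> R) : set (S -> X -> R) :=
  [set Q | is_kernel Q /\ Rp PS QX Q = 1 / 2%:R]%classic.

(* Main.v *)
(* For a fixed token x, every test declares H_1 either for no s, or for some s0.
   Since the average of Q_{X|S=s}(x) over s is QX x, the terms
   "Q_{X|S=s}(x) if H_1 is declared, QX x otherwise" add up to k * QX x in the
   first case, and in the second case to at most k * QX x plus one QX x for
   each s <> s0. Hence they never exceed (2k - 1) * QX x, and summing over x
   gives 1 - 1/(2k). *)
Require Import Defs.
From mathcomp Require Import all_boot all_order all_algebra.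
From mathcomp Require Import classical_sets reals.
From mathcomp Require Import ring lra.

Set Implicit Arguments.
Unset Strict Implicit.
Unset Printing Implicit Defensive.

Import Order.TTheory GRing.Theory Num.Theory.
Local Open Scope ring_scope.

Section OptimalSuccess.
Variables (R : realType) (T : finType).
Implicit Types (P : T -> R) (g : {ffun T -> bool}).

(** With equal priors a test collects at each point the mass of the law it declares, so scores can
    be compared point by point. *)
Lemma success_halfE P0 P1 g :
  success (1 / 2%:R) (1 / 2%:R) P0 P1 g
  = 1 / 2%:R * \sum_t (if g t then P1 t else P0 t).
Proof.
rewrite /success /prob -mulrDr; congr (_ * _).
rewrite [RHS](bigID (fun t => g t == false)) /=; congr (_ + _).
  by apply: eq_bigr => t /eqP ->.
by apply: eq_big => t; case: (g t).
Qed.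

Lemma success_le_opt (pi0 pi1 : R) P0 P1 g :
  success pi0 pi1 P0 P1 g <= opt_success pi0 pi1 P0 P1.
Proof. exact: le_bigmax. Qed.

Lemma opt_success_le (pi0 pi1 B : R) P0 P1 :
  (forall g, success pi0 pi1 P0 P1 g <= B) -> opt_success pi0 pi1 P0 P1 <= B.
Proof. by move=> leB; apply: bigmax_le. Qed.

(** Always declaring H_0 is right exactly when H_0 holds, which has prior 1/2. *)
Lemma half_le_opt_success P0 P1 : \sum_t P0 t = 1 ->
  1 / 2%:R <= opt_success (1 / 2%:R) (1 / 2%:R) P0 P1.
Proof.
move=> P0_1; apply: le_trans (success_le_opt _ _ _ _ [ffun=> false]).
rewrite success_halfE (eq_bigr P0) ?P0_1 ?mulr1 // => t _.
by rewrite ffunE.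
Qed.

(** If the laws agree, every test scores 1/2. Conversely, one-point tests give [P1 <= P0] pointwise,
    and equal total mass then forces equality. *)
Lemma opt_success_eq_half P0 P1 : \sum_t P0 t = 1 -> \sum_t P1 t = 1 ->
  opt_success (1 / 2%:R) (1 / 2%:R) P0 P1 = 1 / 2%:R <-> P1 = P0.
Proof.
move=> P0_1 P1_1; split=> [opt_half|->]; last first.
  apply/le_anti; rewrite half_le_opt_success // andbT.
  apply: opt_success_le => g; rewrite success_halfE.
  by rewrite (eq_bigr P0) ?P0_1 ?mulr1 // => t _; case: (g t).
(* The test declaring H_1 exactly at t has success (1 + P1 t - P0 t) / 2. *)
have P1_le t : P1 t <= P0 t.
  have := success_le_opt (1 / 2%:R) (1 / 2%:R) P0 P1 [ffun u => u == t].
  rewrite opt_half success_halfE (bigD1 t) //= ffunE eqxx.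
  rewrite (eq_bigr P0) => [|u /negPf u_t]; last by rewrite ffunE u_t.
  move: P0_1; rewrite (bigD1 t) //=; lra.
apply/boolp.funext => t; apply/eqP; rewrite eq_sym -subr_eq0; apply/eqP.
apply: (@psumr_eq0P _ _ xpredT (fun u => P0 u - P1 u)) => // [u _|].
  by rewrite subr_ge0.
by rewrite sumrB P0_1 P1_1 subrr.
Qed.

End OptimalSuccess.

Lemma sum_joint (R : realType) (S X : finType) (PS : S -> R)
    (Q : S -> X -> R) : \sum_s PS s = 1 -> (forall s, \sum_x Q s x = 1) ->
  \sum_(t : X * S) Q t.2 t.1 * PS t.2 = 1.
Proof.
move=> PS1 Q1.
rewrite -(pair_bigA _ (fun x s => Q s x * PS s)) exchange_big /= -[RHS]PS1.
by apply: eq_bigr => s _; rewrite -mulr_suml Q1 mul1r.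
Qed.

Lemma sum_mixture (R : realType) (S X : finType) (PS : S -> R)
    (Q : S -> X -> R) : \sum_s PS s = 1 -> (forall s, \sum_x Q s x = 1) ->
  \sum_x mixture PS Q x = 1.
Proof.
move=> PS1 Q1; rewrite /mixture exchange_big /= -[RHS]PS1.
by apply: eq_bigr => s _; rewrite -mulr_sumr Q1 mulr1.
Qed.

Lemma sum_uniform (R : realType) (S : finType) : (0 < #|S|)%N ->
  \sum_s uniform R S s = 1.
Proof.
move=> S_gt0; rewrite /uniform sumr_const -(mulr_natr _^-1) mulVf //.
by rewrite pnatr_eq0 -lt0n.
Qed.

(** Serves for one token [x] at a time, with [Q s x] as [a s] and [QX x] as [c]. *)
Lemma sum_test_le (R : realType) (S : finType) (a : S -> R) (c : R)
    (g : pred S) : (0 < #|S|)%N -> (forall s, 0 <= a s) ->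
    \sum_s a s = #|S|%:R * c ->
  \sum_s (if g s then a s else c) <= (2%:R * #|S|%:R - 1) * c.
Proof.
move=> S_gt0 a_ge0 sum_a.
have cardS_ge1 : 1 <= #|S|%:R :> R by rewrite ler1n.
(* As the average of the [a s], [c] inherits their sign. *)
have c_ge0 : 0 <= c.
  by rewrite -(pmulr_rge0 _ (lt_le_trans ltr01 cardS_ge1)) -sum_a sumr_ge0.
(* If H_1 is never declared, the sum is k [c] with k = [#|S|], and k <= 2k - 1 since k >= 1. *)
case: (pickP g) => [s0 g_s0|g0]; last first.
  rewrite (eq_bigr (fun=> c)) => [|s _]; last by rewrite g0.
  rewrite sumr_const -(mulr_natl c) ler_wpM2r //; lra.
have sum_c : \sum_(s | s != s0) c = (#|S|%:R - 1) * c.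
  have := sumr_const S c; rewrite (bigD1 s0) //= -(mulr_natl c); lra.
(* Of the 2k - 1 copies of [c], k are traded for the sum of [a], and one is left for each [s != s0].
   There [a s + c] dominates both possible terms. *)
have -> : (2%:R * #|S|%:R - 1) * c = a s0 + \sum_(s | s != s0) (a s + c).
  by move: sum_a; rewrite (bigD1 s0) //= big_split /= sum_c; lra.
rewrite (bigD1 s0) //= g_s0 lerD2l; apply: ler_sum => s _.
by case: (g s); rewrite ?lerDl ?lerDr.
Qed.

Lemma Rd_uniform_le (R : realType) (X S : finType) (QX : X -> R)
    (Q : S -> X -> R) : (0 < #|S|)%N -> is_dist QX -> is_kernel Q ->
    mixture (uniform R S) Q = QX ->
  Rd (1 / 2%:R) (1 / 2%:R) (uniform R S) QX Q <= 1 - 1 / (2%:R * #|S|%:R).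
Proof.
move=> S_gt0 [_ QX1] kerQ mixQ; set k : R := #|S|%:R.
have k_neq0 : k != 0 by rewrite pnatr_eq0 -lt0n.
have k_gt0 : 0 < k by rewrite ltr0n.
apply: opt_success_le => g; rewrite success_halfE.
(* Both joint laws carry the same factor 1/k from the uniform law, so it comes out whatever [g]
   declares. *)
have -> : \sum_t (if g t then joint1 (uniform R S) Q t
                  else joint0 (uniform R S) QX t)
    = k^-1 * \sum_x \sum_s (if g (x, s) then Q s x else QX x).
  rewrite (pair_bigA _ (fun x s => if g (x, s) then Q s x else QX x)) mulr_sumr.
  apply: eq_bigr => -[x s] _ /=.
  by rewrite /joint1 /joint0 /uniform /=; case: (g _); rewrite mulrC.
have le_sum : \sum_x \sum_s (if g (x, s) then Q s x else QX x) <= 2%:R * k - 1.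
  (* Since [QX] has mass one, the bound splits into shares (2k - 1) [QX x], one per token. *)
  rewrite -[leRHS]mulr1 -[X in _ <= _ * X]QX1 mulr_sumr; apply: ler_sum => x _.
  apply: (@sum_test_le _ _ (Q ^~ x) _ (fun s => g (x, s))) => // [s|].
    by case: (kerQ s).
  by rewrite -mixQ /mixture -mulr_sumr mulVKf.
have -> : 1 - 1 / (2%:R * k) = 1 / 2%:R * (k^-1 * (2%:R * k - 1)) by field.
by rewrite !ler_wpM2l // ?invr_ge0 ?divr_ge0 ?ltW.
Qed.

Theorem theorem1 (R : realType) (X S : finType) (k : nat)
    (hX : (0 < #|X|)%N) (hS : (0 < #|S|)%N)
    (hk : #|S| = k) (hkX : (k <= #|X|)%N)
    (QX : X -> R) (hQX : is_dist QX)
    (PS : S -> R) (hPS : PS = uniform R S)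
    (pi0 pi1 gamma : R) (hpi1 : pi1 = 1 / 2%:R) (hpi0 : pi0 = 1 - pi1)
    (hgamma : gamma = pi1 / pi0) :
  (forall Q : S -> X -> R, is_kernel Q ->
     (Rp PS QX Q = 1 / 2%:R <-> mixture PS Q = QX)) /\
  1 / 2%:R <= sup [set Rd pi0 pi1 PS QX Q | Q in perfect_perception PS QX]%classic
    <= Num.max (1 / 2%:R) (1 - gamma / (2%:R * k%:R)).
Proof.
have {hpi0 hpi1} [e1 e0] : pi1 = 1 / 2%:R /\ pi0 = 1 / 2%:R.
  by split=> //; rewrite hpi0 hpi1; field.
have PS1 := sum_uniform R hS; have [_ QX1] := hQX.
have {hgamma} -> : gamma = 1.
  by rewrite hgamma e1 e0 divff // mul1r invr_eq0 pnatr_eq0.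
subst pi0 pi1 PS k.
have perception (Q : S -> X -> R) : is_kernel Q ->
    (Rp (uniform R S) QX Q = 1 / 2%:R <-> mixture (uniform R S) Q = QX).
  move=> kerQ; apply: opt_success_eq_half => //.
  by apply: sum_mixture => // s; case: (kerQ s).
split=> //; set A := [set _ | _ in _]%classic.
have A_ub : ubound A (1 - 1 / (2%:R * #|S|%:R)).
  by move=> _ [Q [kerQ /(perception _ kerQ) mixQ] <-]; apply: Rd_uniform_le.
(* The kernel that ignores [s] and draws from [QX] averages to [QX]. It makes [A] nonempty and also
   witnesses the lower bound. *)
have A_ex : A (Rd (1 / 2%:R) (1 / 2%:R) (uniform R S) QX (fun=> QX)).
  exists (fun=> QX) => //; have kerQX : is_kernel (fun _ : S => QX) by [].
  split=> //; apply/perception => //; apply/boolp.funext => x.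
  by rewrite /mixture -mulr_suml PS1 mul1r.
have A_has_ub : has_ubound A by exists (1 - 1 / (2%:R * #|S|%:R)).
apply/andP; split; last first.
  (* With gamma equal to 1, the second argument of the maximum is the bound of [A_ub]. *)
  rewrite le_max; apply/orP; right.
  by apply: ge_sup A_ub; eexists; apply: A_ex.
apply: le_trans (ub_le_sup A_has_ub A_ex).
(* [joint0] has the form of [joint1] for the constant kernel [QX], hence total mass one. *)
by apply: half_le_opt_success; apply: (sum_joint (Q := fun=> QX)).
Qed.
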